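(* Let $n\in\mathbb{N}$. Then $R_nR_n\subset R_n$, i.e. the matrix product of any two elements of $R_n$ is again an element of $R_n$.
   Context: $R_n$ is the space of matrices $M\in\mathbb{R}^{n\times n}$ such that $M_{i,j}+M_{i,n+1-j}=M_{i,k}+M_{i,n+1-k}$ and $M_{i,j}+M_{n+1-i,j}=M_{k,j}+M_{n+1-k,j}$ for all $i,j,k\in\{1,\dots,n\}$. *)

(* Defs.v *)
From mathcomp Require Import all_boot all_order all_algebra.
From mathcomp Require Import classical_sets reals.

Set Implicit Arguments.
Unset Strict Implicit.
Unset Printing Implicit Defensive.

Import GRing.Theory.
Local Open Scope classical_set_scope.
Local Open Scope ring_scope.

(* Indices run over 0, ..., n - 1 instead of 1, ..., n, so the reflection
   j |-> n + 1 - j becomes j |-> n - 1 - j, which is [rev_ord]. *)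
Definition Rspace (R : realType) (n : nat) : set 'M[R]_n :=
  [set M | (forall i j k : 'I_n,
              M i j + M i (rev_ord j) = M i k + M i (rev_ord k)) /\
           (forall i j k : 'I_n,
              M i j + M (rev_ord i) j = M k j + M (rev_ord k) j)].

Arguments Rspace R n : clear implicits.

(* Main.v *)
Require Import Defs.
From mathcomp Require Import all_boot all_order all_algebra.
From mathcomp Require Import classical_sets reals.

Import GRing.Theory.

Local Open Scope classical_set_scope.
Local Open Scope ring_scope.

Theorem theorem12 (R : realType) (n : nat) (M N : 'M[R]_n) :
  Rspace R n M -> Rspace R n N -> Rspace R n (M *m N).
Proof.
(* Reflecting a column of the product only reflects a column of [N], and reflecting a row only a row
   of [M]; so each condition can be checked term by term in the sum over the inner index [l]. *)
move=> [_ Mcol] [Nrow _]; split=> i j k; rewrite !mxE -!big_split /=.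
(* The common factor [M i l] leaves a reflected pair sum in row [l] of [N], which is the same for
   [j] and [k]. *)
- by apply: eq_bigr => l _; rewrite -!mulrDr (Nrow l j k).
(* Dually, the common factor [N l j] leaves a pair sum in column [l] of [M]. *)
- by apply: eq_bigr => l _; rewrite -!mulrDl (Mcol i l k).
Qed.
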